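(* Let $V$ be a finite-dimensional real inner product space, let $A\colon V\to V$ be symmetric positive semidefinite with $A\ne0$, let $B\colon V\to V$ be a linear operator, and let $Q\colon V\to\mathcal R(A)$ be the orthogonal projection onto $\mathcal R(A)$. If the operator $B_Q=QBQ^t\colon\mathcal R(A)\to\mathcal R(A)$ is SPD, then $$\lambda_{\min}(BA)=\left(\sup_{v\in\mathcal R(A),\ |v|_A=1}(B_Q^{-1}v,v)\right)^{-1},\qquad \lambda_{\max}(BA)=\left(\inf_{v\in\mathcal R(A),\ |v|_A=1}(B_Q^{-1}v,v)\right)^{-1}.$$
   Context: $\mathcal R(T)$ is the range of a linear operator $T$; $Q^t$ is the natural embedding $\mathcal R(A)\to V$. A symmetric operator $T$ is SPD if $(Tv,v)>0$ for all $v\ne0$, and symmetric positive semidefinite if $(Tv,v)\ge 0$ for all $v$; then $|v|_T=(Tv,v)^{1/2}$. $\lambda_{\min}(BA)$ denotes the smallest nonzero eigenvalue and $\lambda_{\max}(BA)$ the largest eigenvalue of $BA$. *)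

(* Defs.v *)
From mathcomp Require Import all_boot all_order all_algebra sesquilinear.
From mathcomp Require Import all_classical all_reals.
Set Implicit Arguments.
Unset Strict Implicit.
Unset Printing Implicit Defensive.
Import Order.TTheory GRing.Theory Num.Theory.
Local Open Scope ring_scope.

(* [ip] is an arbitrary binary function so that the notions below apply both to
   the inner product of V and to its restriction to a subspace. *)
Definition symmetric_op (R : realType) (W : vectType R) (ip : W -> W -> R)
  (T : 'End(W)) : Prop := forall v w, ip (T v) w = ip v (T w).

Definition spd (R : realType) (W : vectType R) (ip : W -> W -> R)
  (T : 'End(W)) : Prop :=
  symmetric_op ip T /\ forall v, v != 0 -> 0 < ip (T v) v.

Definition spsd (R : realType) (W : vectType R) (ip : W -> W -> R)
  (T : 'End(W)) : Prop :=
  symmetric_op ip T /\ forall v, 0 <= ip (T v) v.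

Definition op_seminorm (R : realType) (W : vectType R) (ip : W -> W -> R)
  (T : 'End(W)) (v : W) : R := Num.sqrt (ip (T v) v).

Definition restr_form (R : realType) (V : vectType R) (ip : V -> V -> R)
  (U : {vspace V}) (x y : subvs_of U) : R := ip (vsval x) (vsval y).

Definition embedding (R : realType) (V : vectType R) (U : {vspace V}) :
  'Hom(subvs_of U, V) := linfun (@vsval R V U).

Definition is_orth_proj (R : realType) (V : vectType R)
  (ip : {dot V for idfun}) (U : {vspace V}) (Q : 'Hom(V, subvs_of U)) : Prop :=
  forall v, v - vsval (Q v) \in orthov ip U.

(* The library predicate [passmx.leigenvalue T a] says that the scalar [a] of the
   base field has a nonzero eigenvector. *)
Definition is_lambda_min (R : realType) (W : vectType R) (T : 'End(W)) (l : R) :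
  Prop :=
  [/\ passmx.leigenvalue T l, l != 0 &
      forall m, passmx.leigenvalue T m -> m != 0 -> l <= m].

Definition is_lambda_max (R : realType) (W : vectType R) (T : 'End(W)) (l : R) :
  Prop :=
  passmx.leigenvalue T l /\ forall m, passmx.leigenvalue T m -> m <= l.

(* Main.v *)
(* The nonzero eigenvalues of BA are the inverses of the eigenvalues of
   T = (A|_U)^-1 B_Q^-1 on U = R(A): an eigenvector v of T gives the eigenvector
   BAv of BA, and an eigenvector x of BA gives the eigenvector Qx of T, because
   AQ = A. The operator T is symmetric for the inner product (A., .) of U, and
   (B_Q^-1 v, v) = (ATv, v), so the supremum and infimum in the statement are
   those of the Rayleigh quotient of T, that is its extreme eigenvalues. *)
Require Import Defs.
From HB Require Import structures.
From mathcomp Require Import all_boot all_order all_algebra sesquilinear.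
From mathcomp Require Import all_classical all_reals.
From mathcomp Require Import ring lra.
Set Implicit Arguments.
Unset Strict Implicit.
Unset Printing Implicit Defensive.
Import Order.TTheory GRing.Theory Num.Theory.
Local Open Scope classical_set_scope.
Local Open Scope ring_scope.

(** * Symmetric bilinear forms, possibly degenerate *)

Record symbil (R : realType) (W : vectType R) (a : W -> W -> R) : Prop := {
  symbilC : forall x y, a x y = a y x;
  symbilP : forall c x y z, a (c *: x + y) z = c * a x z + a y z }.

Section SymmetricForms.
Variables (R : realType) (W : vectType R) (a : W -> W -> R).
Hypothesis ha : symbil a.

Lemma symbil0l z : a 0 z = 0.
Proof. by have := symbilP ha (-1) 0 0 z; rewrite scaler0 addr0 mulN1r addNr. Qed.

Lemma symbilZl c x z : a (c *: x) z = c * a x z.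
Proof. by rewrite -[c *: x]addr0 (symbilP ha) symbil0l addr0. Qed.

Lemma symbilDl x y z : a (x + y) z = a x z + a y z.
Proof. by rewrite -[x]scale1r (symbilP ha) mul1r scale1r. Qed.

Lemma symbilNl x z : a (- x) z = - a x z.
Proof. by rewrite -scaleN1r symbilZl mulN1r. Qed.

Lemma symbilBl x y z : a (x - y) z = a x z - a y z.
Proof. by rewrite symbilDl symbilNl. Qed.

Lemma symbilZr c x z : a z (c *: x) = c * a z x.
Proof. by rewrite (symbilC ha) symbilZl (symbilC ha). Qed.

Lemma symbilDr x y z : a z (x + y) = a z x + a z y.
Proof. by rewrite (symbilC ha) symbilDl !(symbilC ha z). Qed.

Lemma symbil_suml n (f : 'I_n -> W) z : a (\sum_i f i) z = \sum_i a (f i) z.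
Proof.
by apply: (big_morph (fun x => a x z)) => [x y|]; rewrite (symbilDl, symbil0l).
Qed.

(** The quadratic form of [t *: x + u *: y] is nonnegative for all [t], [u]. Isotropic nonzero
    vectors are allowed, as the kernel arguments below require. *)
Lemma symbil_CauchySchwarz : (forall x, 0 <= a x x) ->
  forall x y, a x y ^+ 2 <= a x x * a y y.
Proof.
move=> a_ge0 x y.
have key t u : 0 <= t ^+ 2 * a x x + 2 * (t * u) * a x y + u ^+ 2 * a y y.
  have := a_ge0 (t *: x + u *: y).
  rewrite symbilDl !symbilDr !symbilZl !symbilZr (symbilC ha y x).
  by congr (0 <= _); ring.
have [x0|x0] := eqVneq (a x x) 0.
  have [->|xy0] := eqVneq (a x y) 0; first by rewrite x0 mul0r expr0n.
  (* With [a x x = 0] and [u = 1] the form is affine in [t], with slope [2 * a x y]; this [t] gives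
     it the value -1. *)
  have := key (- (a y y + 1) / (2 * a x y)) 1.
  rewrite x0.
  have -> : 2 * (- (a y y + 1) / (2 * a x y) * 1) * a x y = - (a y y + 1).
    by field.
  lra.
have xp : 0 < a x x by rewrite lt_def x0 a_ge0.
have := key (- a x y) (a x x).
have -> : (- a x y) ^+ 2 * a x x + 2 * (- a x y * a x x) * a x y
          + a x x ^+ 2 * a y y = a x x * (a x x * a y y - a x y ^+ 2) by ring.
by rewrite pmulr_rge0 // subr_ge0.
Qed.

Hypothesis a_gt0 : forall x, x != 0 -> 0 < a x x.

Lemma symbil_pos_ge0 x : 0 <= a x x.
Proof. by have [->|/a_gt0/ltW//] := eqVneq x 0; rewrite symbil0l. Qed.

(** Riesz representation of the coordinate functionals. The map sending [w] to the row of all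
    [a w e_j] is injective by definiteness, hence onto by dimension; [g i] is a preimage of the i-th
    unit row. *)
Lemma symbil_riesz (e : (\dim {:W}).-tuple W) :
  basis_of {:W} e -> exists g : 'I_(\dim {:W}) -> W,
  forall i v, a (g i) v = coord e i v.
Proof.
move=> be; set n := \dim {:W} in e be *.
pose h0 (w : W) : 'rV[R]_n := \row_j a w e`_j.
have h0_lin : linear h0.
  by move=> c x y; apply/rowP=> j; rewrite !mxE (symbilP ha).
pose hl := GRing.isLinear.Build _ _ _ _ h0 h0_lin.
pose hL : {linear W -> 'rV[R]_n} := HB.pack h0 hl.
pose h := linfun hL.
have kh : lker h == 0%VS.
  rewrite -subv0; apply/subvP => w.
  rewrite memv_ker lfunE /= => /eqP/rowP w0.
  have aw v : a w v = 0.
    rewrite (coord_basis be (memvf v)) (symbilC ha) symbil_suml.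
    apply: big1 => i _; rewrite symbilZl (symbilC ha).
    by have := w0 i; rewrite !mxE => ->; rewrite mulr0.
  by rewrite memv0; apply/negPn/negP => /a_gt0; rewrite aw ltxx.
have fh : limg h = fullv.
  apply/eqP; rewrite eqEdim subvf /= dimvf.
  have := limg_ker_dim h fullv; rewrite (eqP kh) capv0 dimv0 add0n => ->.
  by rewrite /dim /= mul1n.
exists (fun i => (h^-1)%VF (delta_mx 0 i)) => i v.
have := @limg_lfunVK _ _ _ h (delta_mx 0 i); rewrite fh memvf => /(_ isT).
rewrite [LHS]lfunE /=; set g := (h^-1)%VF _ => /rowP hg.
rewrite {1}(coord_basis be (memvf v)) (symbilC ha) symbil_suml.
rewrite (bigD1 i) //= big1 => [|j ji]; rewrite symbilZl (symbilC ha).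
  by have := hg i; rewrite !mxE !eqxx => ->; rewrite mulr1 addr0.
by have := hg j; rewrite !mxE eqxx /= (negPf ji) => ->; rewrite mulr0.
Qed.

(** Expanding the first [v] in a basis turns [a (G v) v] into the sum of the products
    [a (g i) v * a (G e_i) v]. Each is at most half the sum of the two squares, which Cauchy-Schwarz
    bounds. The summand 1 makes the constant positive. *)
Lemma symbil_bounded (G : 'End(W)) :
  exists2 C, 0 < C & forall v, a (G v) v <= C * a v v.
Proof.
pose e := vbasis {:W}; have [g hg] := symbil_riesz (vbasisP {:W}).
exists (1 + \sum_i (a (g i) (g i) + a (G e`_i) (G e`_i))).
  by rewrite ltr_pwDl// sumr_ge0// => i _; rewrite addr_ge0 ?symbil_pos_ge0.
move=> v; have v0 := symbil_pos_ge0 v.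
rewrite {1}(coord_vbasis (memvf v)) linear_sum symbil_suml mulrDl mul1r.
rewrite ler_wpDl // mulr_suml ler_sum // => i _.
rewrite linearZ symbilZl -hg.
have := symbil_CauchySchwarz symbil_pos_ge0 (g i) v.
have := symbil_CauchySchwarz symbil_pos_ge0 (G e`_i) v.
have := symbil_pos_ge0 (g i); have := symbil_pos_ge0 (G e`_i).
rewrite -/e; set p := a (g i) v; set q := a (G _) v.
have := sqr_ge0 (p - q); nra.
Qed.

End SymmetricForms.

(** * Eigenvalues and Rayleigh quotients *)

Lemma mem_leigenspace (R : realType) (W : vectType R) (T : 'End(W)) (l : R) v :
  (v \in passmx.leigenspace T l) = (T v == l *: v).
Proof.
by rewrite memv_ker add_lfunE opp_lfunE scale_lfunE id_lfunE subr_eq0.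
Qed.

Lemma leigenvalueP (R : realType) (W : vectType R) (T : 'End(W)) (l : R) :
  reflect (exists2 v, v != 0 & T v = l *: v) (passmx.leigenvalue T l).
Proof.
apply: (iffP idP) => [|[v v0 Tv]].
  rewrite /passmx.leigenvalue -vpick0 => v0.
  exists (vpick (passmx.leigenspace T l)) => //.
  by apply/eqP; rewrite -mem_leigenspace memv_pick.
by apply: contra v0 => /eqP e0; rewrite -memv0 -e0 mem_leigenspace Tv.
Qed.

Definition rayleigh_values (R : realType) (W : vectType R) (a : W -> W -> R)
  (T : 'End(W)) : set R := [set a (T v) v | v in [set v | a v v = 1]].

Section Rayleigh.
Variables (R : realType) (W : vectType R) (a : W -> W -> R) (T : 'End(W)).
Hypotheses (ha : symbil a) (a_gt0 : forall x, x != 0 -> 0 < a x x).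
Hypothesis (T_sym : forall x y, a (T x) y = a x (T y)).

Lemma rayleigh_mem v : v != 0 -> rayleigh_values a T (a (T v) v / a v v).
Proof.
move=> /a_gt0 v0; have v1 : 0 <= a v v by apply: ltW.
exists ((Num.sqrt (a v v))^-1 *: v); rewrite /= ?linearZ /=.
  rewrite (symbilZl ha) (symbilZr ha) mulrA -invfM -expr2 sqr_sqrtr //.
  by rewrite mulVf // gt_eqF.
rewrite (symbilZl ha) (symbilZr ha) mulrA -invfM -expr2 sqr_sqrtr //.
by rewrite mulrC.
Qed.

Lemma rayleigh_has_sup : {:W}%VS != 0%VS -> has_sup (rayleigh_values a T).
Proof.
rewrite -vpick0 => /rayleigh_mem Wv; split; first by eexists; exact: Wv.
have [C _ hC] := symbil_bounded ha a_gt0 T.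
by exists C => _ [v /= v1 <-]; have := hC v; rewrite v1 mulr1.
Qed.

Lemma rayleigh_eigenvalue l : passmx.leigenvalue T l -> rayleigh_values a T l.
Proof.
move=> /leigenvalueP[v v0 Tv]; have := rayleigh_mem v0.
by rewrite Tv (symbilZl ha) mulfK // gt_eqF ?a_gt0.
Qed.

(* If s - T were injective, Cauchy-Schwarz for the semidefinite form
   (s - T) would give a(v, v) <= C a((s - T) v, v), so that s - 1/C would still
   bound the Rayleigh quotients: this replaces the compactness of the sphere. *)
Lemma sup_rayleigh_eigenvalue : {:W}%VS != 0%VS ->
  passmx.leigenvalue T (sup (rayleigh_values a T)).
Proof.
move=> W0; have hS := rayleigh_has_sup W0; set s := sup _.
pose N : 'End(W) := (s *: \1 - T)%VF.
have NE v : N v = s *: v - T v.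
  by rewrite add_lfunE opp_lfunE scale_lfunE id_lfunE.
pose n x y := a (N x) y.
have hn : symbil n.
  split => [x y|c x y z]; rewrite /n; last by rewrite linearP (symbilP ha).
  rewrite !NE !(symbilBl ha) !(symbilZl ha) (T_sym x).
  by rewrite (symbilC ha y x) (symbilC ha (T y)).
have n_ge0 v : 0 <= n v v.
  have [->|v0] := eqVneq v 0; first by rewrite symbil0l.
  rewrite /n NE (symbilBl ha) (symbilZl ha) subr_ge0 -ler_pdivrMr ?a_gt0//.
  by apply: sup_upper_bound => //; exact: rayleigh_mem.
rewrite /passmx.leigenvalue; apply/negP => /eqP k0.
have kN : lker N == 0%VS.
  rewrite -subv0; apply/subvP => v; rewrite memv_ker NE subr_eq0 -k0 => /eqP v0.
  by rewrite mem_leigenspace v0.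
have [C C0 hC] := symbil_bounded ha a_gt0 (N^-1)%VF.
have : s <= s - C^-1.
  apply: sup_le_ub; first by case: hS.
  move=> _ [v /= v1 <-].
  (* For this pair the mixed term is [a v v = 1] and the first square is [a (N^-1 v) v], which is at
     most [C]. *)
  have := symbil_CauchySchwarz hn n_ge0 ((N^-1)%VF v) v.
  rewrite {1 2}/n lker0_lfunVK // v1 expr1n (symbilC ha v) => h1.
  have := hC v; rewrite v1 mulr1 => h2.
  have h3 : n v v = s - a (T v) v.
    by rewrite /n NE (symbilBl ha) (symbilZl ha) v1 mulr1.
  have : 1 <= C * n v v.
    by apply: le_trans h1 _; rewrite ler_wpM2r.
  rewrite h3 mulrC -ler_pdivrMr // div1r; lra.
by rewrite lerDl oppr_ge0 invr_le0 leNgt C0.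
Qed.

Lemma rayleigh_opp : rayleigh_values a (- T) = -%R @` rayleigh_values a T.
Proof.
apply/seteqP; split => [_ [v v1 <-]|_ [_ [v v1 <-] <-]].
  by exists (a (T v) v); [exists v|rewrite lfunE /= (symbilNl ha)].
by exists v => //; rewrite lfunE /= (symbilNl ha).
Qed.

End Rayleigh.

Section RayleighInf.
Variables (R : realType) (W : vectType R) (a : W -> W -> R) (T : 'End(W)).
Hypotheses (ha : symbil a) (a_gt0 : forall x, x != 0 -> 0 < a x x).
Hypothesis (T_sym : forall x y, a (T x) y = a x (T y)).

Lemma rayleigh_has_inf : {:W}%VS != 0%VS -> has_inf (rayleigh_values a T).
Proof.
move=> W0; apply/has_inf_supN; rewrite -rayleigh_opp//.
exact: rayleigh_has_sup.
Qed.

(** The infimum is minus the supremum of the Rayleigh values of [- T], whose eigenvectors are those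
    of [T] with opposite eigenvalues. *)
Lemma inf_rayleigh_eigenvalue : {:W}%VS != 0%VS ->
  passmx.leigenvalue T (inf (rayleigh_values a T)).
Proof.
move=> W0; rewrite /inf -rayleigh_opp//.
have NT_sym x y : a ((- T)%VF x) y = a x ((- T)%VF y).
  by rewrite !opp_lfunE (symbilNl ha) T_sym !(symbilC ha x) (symbilNl ha).
have /leigenvalueP[v v0 Tv] := sup_rayleigh_eigenvalue ha a_gt0 NT_sym W0.
apply/leigenvalueP; exists v => //.
by rewrite scaleNr -Tv opp_lfunE opprK.
Qed.

End RayleighInf.

(** * Definite and semidefinite operators *)

Lemma lker0_spd (R : realType) (W : vectType R) (ip : W -> W -> R)
  (T : 'End(W)) : (forall y, ip 0 y = 0) -> spd ip T -> lker T == 0%VS.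
Proof.
move=> ip0 [_ T_gt0]; rewrite -subv0; apply/subvP => v.
rewrite memv_ker memv0; apply: contraTT => /T_gt0.
by apply: contraTneq => ->; rewrite ip0 ltxx.
Qed.

Section DotProduct.
Variables (R : realType) (V : vectType R) (ip : {dot V for idfun}).

Lemma symbil_dot : symbil ip.
Proof.
split=> [x y|c x y z]; first by rewrite (@hermC _ false idfun) expr0 mul1r.
by rewrite linearPl.
Qed.

Lemma symbil_restr (U : {vspace V}) : symbil (@restr_form R V ip U).
Proof.
split=> [x y|c x y z]; first exact: (symbilC symbil_dot).
by rewrite /restr_form linearP (symbilP symbil_dot).
Qed.

Variable A : 'End(V).
Hypothesis hA : spsd ip A.

Lemma symbil_spsd : symbil (fun x y => ip (A x) y).
Proof.
have [A_sym _] := hA.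
split=> [x y|c x y z]; last by rewrite linearP (symbilP symbil_dot).
by rewrite A_sym (symbilC symbil_dot).
Qed.

(** Cauchy-Schwarz for the form (A., .) at [x] and [A x] bounds the square of (Ax, Ax) by a multiple
    of (Ax, x). *)
Lemma spsd_ker x : ip (A x) x = 0 -> A x = 0.
Proof.
have [_ A_ge0] := hA; move=> Ax0; apply/eqP/negPn/negP => Ax_n0.
have h2 : 0 < ip (A x) (A x) by exact: neq0_dnorm_gt0.
have := symbil_CauchySchwarz symbil_spsd A_ge0 x (A x).
rewrite Ax0 mul0r => h1.
by have := lt_le_trans (exprn_gt0 2 h2) h1; rewrite ltxx.
Qed.

(** If (Ax, x) = 0 then Ax = 0, and writing x = Ay gives (x, x) = (y, Ax) = 0. *)
Lemma spsd_limg_gt0 x : x \in limg A -> x != 0 -> 0 < ip (A x) x.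
Proof.
have [A_sym A_ge0] := hA; move=> xU x0; rewrite lt_def A_ge0 andbT.
apply/eqP => /spsd_ker Ax0.
have /memv_imgP[y _ xE] := xU.
have : 0 < ip x x by exact: neq0_dnorm_gt0.
by rewrite {1}xE A_sym Ax0 (symbilC symbil_dot) (symbil0l symbil_dot) ltxx.
Qed.

(** Since Az lies in the range, (Az, z) = (z, Az) = 0. Applied to x - Qx, this gives AQ = A. *)
Lemma spsd_orth z : z \in orthov ip (limg A) -> A z = 0.
Proof.
move=> /mem_orthovP zU; apply: spsd_ker; have [-> _] := hA.
by apply: zU; rewrite memv_img ?memvf.
Qed.

End DotProduct.

(** * Transfer of eigenvalues between BA and an operator on the range of A *)

Theorem theorem4p7 (R : realType) (V : vectType R) (ip : {dot V for idfun})
  (A B : 'End(V)) (Q : 'Hom(V, subvs_of (limg A))) :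
  spsd ip A -> A != 0 ->
  is_orth_proj ip Q ->
  let BQ : 'End(subvs_of (limg A)) :=
    (Q \o (B \o embedding (limg A)))%VF in
  spd (@restr_form R V ip (limg A)) BQ ->
  let S := [set restr_form ip ((BQ^-1)%VF v) v
           | v in [set v : subvs_of (limg A) |
                   op_seminorm ip A (vsval v) = 1]] in
  is_lambda_min (B \o A)%VF (sup S)^-1 /\
  is_lambda_max (B \o A)%VF (inf S)^-1.
Proof.
move=> hA A0 hQ BQ hBQ S; have [A_sym A_ge0] := hA; have [BQ_sym BQ_gt0] := hBQ.
set U := limg A in Q hQ BQ hBQ BQ_sym BQ_gt0 S *.
have BQE w : BQ w = Q (B (vsval w)) by rewrite !comp_lfunE lfunE.
have AQ x : A (vsval (Q x)) = A x.
  have /eqP := spsd_orth hA (hQ x).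
  by rewrite linearB subr_eq0 => /eqP.
(* The restriction of [A] to its range; [vsproj] only retypes values that already lie in [U]. *)
pose AU : 'End(subvs_of U) := (linfun (vsproj U) \o (A \o embedding U))%VF.
have AUE w : vsval (AU w) = A (vsval w).
  by rewrite !comp_lfunE !lfunE /= vsprojK // memv_img ?memvf.
pose a x y := restr_form ip (AU x) y.
have hr := symbil_restr ip U.
have ha : symbil a.
  split=> [x y|c x y z]; last by rewrite /a linearP (symbilP hr).
  by rewrite /a /restr_form !AUE; exact: (symbilC (symbil_spsd hA)).
have a_gt0 x : x != 0 -> 0 < a x x.
  by move=> x0; rewrite /a /restr_form AUE (spsd_limg_gt0 hA) ?subvsP.
have kAU : lker AU == 0%VS.
  rewrite -subv0; apply/subvP => v; rewrite memv_ker memv0; apply: contraTT.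
  by move=> /a_gt0; apply: contraTneq => v0; rewrite /a v0 (symbil0l hr) ltxx.
have kBQ : lker BQ == 0%VS by apply: (lker0_spd (symbil0l hr) hBQ).
have BQV_gt0 v : v != 0 -> 0 < restr_form ip ((BQ^-1)%VF v) v.
  move=> v0; have := BQ_gt0 ((BQ^-1)%VF v); rewrite lker0_lfunVK //.
  rewrite (symbilC hr); apply; apply: contra v0 => /eqP v0.
  by rewrite -(lker0_lfunVK kBQ v) v0 linear0.
pose T : 'End(subvs_of U) := (AU^-1 \o BQ^-1)%VF.
have TE v : AU (T v) = (BQ^-1)%VF v by rewrite [T v]comp_lfunE lker0_lfunVK.
have aT x y : a (T x) y = restr_form ip ((BQ^-1)%VF x) y by rewrite /a TE.
have T_sym x y : a (T x) y = a x (T y).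
  have := BQ_sym ((BQ^-1)%VF x) ((BQ^-1)%VF y).
  by rewrite !lker0_lfunVK // (symbilC ha x) !aT (symbilC hr x).
have -> : S = rayleigh_values a T.
  suff vE v : (op_seminorm ip A (vsval v) = 1) = (a v v = 1).
    by apply/seteqP; split => _ [v /= v1 <-]; exists v; rewrite ?aT //= -?vE // vE.
  have -> : a v v = ip (A (vsval v)) (vsval v) by rewrite /a /restr_form AUE.
  rewrite /op_seminorm; apply/propext; split => [h|->]; last by rewrite sqrtr1.
  by rewrite -[LHS]sqr_sqrtr // h expr1n.
(* A nonzero range makes the set of Rayleigh values nonempty, so that [sup] and [inf] do not take
   their default values. *)
have W0 : ({:subvs_of U} != 0)%VS.
  move: A0; apply: contra => /eqP W0; apply/eqP/lfunP => x.
  have Ax : A x \in U by rewrite memv_img ?memvf.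
  have : vsproj U (A x) \in {:subvs_of U}%VS by rewrite memvf.
  by rewrite W0 memv0 => /eqP p0; rewrite -(vsprojK Ax) p0 linear0 lfunE.
have T_gt0 l : passmx.leigenvalue T l -> 0 < l.
  move=> /leigenvalueP[v v0 Tv]; have := BQV_gt0 v v0.
  by rewrite -aT Tv (symbilZl ha) pmulr_lgt0 ?a_gt0.
(* From BQ(Av) = v / l and AQ = A follows AB(Av) = Av / l; applying B shows that BAv is an
   eigenvector. It is nonzero, since BAv = 0 would force Av = 0. *)
have T_BA l : passmx.leigenvalue T l -> passmx.leigenvalue (B \o A)%VF l^-1.
  move=> Tl; have l0 : l != 0 by rewrite gt_eqF ?T_gt0.
  have /leigenvalueP[v v0 Tv] := Tl.
  have Tv' : (BQ^-1)%VF v = l *: AU v by rewrite -TE Tv linearZ.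
  have AB : A (B (A (vsval v))) = l^-1 *: A (vsval v).
    rewrite -[A (vsval v) in LHS]AUE -[LHS]AQ -BQE -!linearZ.
    congr (A (vsval _)); apply: (scalerI l0).
    by rewrite scalerA mulfV // scale1r -[RHS](lker0_lfunVK kBQ) Tv' linearZ.
  apply/leigenvalueP; exists (B (A (vsval v))); last first.
    by rewrite comp_lfunE AB linearZ.
  apply: contraTneq (a_gt0 _ v0) => B0.
  rewrite /a /restr_form AUE; move/eqP: AB; rewrite B0 linear0 eq_sym.
  rewrite scaler_eq0 invr_eq0 (negPf l0) => /eqP->.
  by rewrite (symbil0l (symbil_dot ip)) ltxx.
(* [T] is the inverse of [BQ \o AU], and the latter maps Qx to QBAx = m Qx. If Qx were zero, then Ax
   = AQx = 0 and m x = 0. *)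
have BA_T m : m != 0 -> passmx.leigenvalue (B \o A)%VF m ->
    passmx.leigenvalue T m^-1.
  move=> m0 /leigenvalueP[x x0]; rewrite comp_lfunE => BAx.
  have BQAU : BQ (AU (Q x)) = m *: Q x by rewrite BQE AUE AQ BAx linearZ.
  have AUQ : AU (Q x) = m *: (BQ^-1)%VF (Q x).
    by rewrite -[LHS](lker0_lfunK kBQ) BQAU linearZ.
  apply/leigenvalueP; exists (Q x).
    apply: contra x0 => /eqP Qx0; have := BAx.
    rewrite -AQ Qx0 !linear0 => /esym/eqP.
    by rewrite scaler_eq0 (negPf m0).
  rewrite comp_lfunE -[(BQ^-1)%VF _]scale1r -(mulVf m0) -scalerA -AUQ.
  by rewrite linearZ /= (lker0_lfunK kAU).
have sup_eig := sup_rayleigh_eigenvalue ha a_gt0 T_sym W0.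
have inf_eig := inf_rayleigh_eigenvalue ha a_gt0 T_sym W0.
have inf_gt0 := T_gt0 _ inf_eig.
split; split; rewrite ?T_BA //.
- by rewrite invr_eq0 gt_eqF ?T_gt0.
(* Inversion reverses the order on the positive eigenvalues of [T], so the smallest nonzero
   eigenvalue of BA comes from the supremum. *)
- move=> m /BA_T mT m0; have mV := mT m0.
  rewrite -[m]invrK lef_pV2 ?posrE ?T_gt0 //.
  apply: sup_upper_bound; first exact: rayleigh_has_sup.
  exact: rayleigh_eigenvalue.
(* The eigenvalue 0 of a singular BA has no counterpart for [T]; it is bounded by the positivity of
   the infimum. *)
- move=> m mBA; have [->|m0] := eqVneq m 0; first by rewrite invr_ge0 ltW.
  have mV := BA_T _ m0 mBA.
  rewrite -[m]invrK lef_pV2 ?posrE ?T_gt0 //.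
  apply: ge_inf; first by case: (rayleigh_has_inf T ha a_gt0 W0).
  exact: rayleigh_eigenvalue.
Qed.
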